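(* Let $(a_n)_{n\ge 1}$ be a positive, non-decreasing, integer-valued sequence with partial sums $S_n=\sum_{i=1}^n a_i$, and suppose that for some real constant $k>1$ one has $S_{2n}=k\,S_n$ for every $n\ge 1$. Set $d=\log_2 k$. (a) If $n=2^r m$ with $r\ge 0$ an integer and $m$ an odd positive integer, then $S_n=c(m)\,n^d$, where $c(m)=\dfrac{S_m}{m^d}$. (b) There exist constants $C_1,C_2>0$ such that $C_1 n^d\le S_n\le C_2 n^d$ for all $n\ge 1$. (c) Consequently, there exist constants $D_1,D_2>0$ such that $D_1 n^{d-1}\le a_n\le D_2 n^{d-1}$ for all $n\ge 1$.
   Context: The relation $S_{2n}=k\,S_n$ for all $n\ge 1$ is called the Galileo relation with constant $k$. The constants $C_1,C_2,D_1,D_2$ may depend on the sequence $(a_n)$ (and on $k$) but not on $n$. *)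

(* Defs.v *)
(* MathComp-Analysis; the reals are an arbitrary R : realType. *)
From mathcomp Require Import all_boot all_order all_algebra.
From mathcomp Require Import all_classical all_reals all_analysis.

Set Implicit Arguments.
Unset Strict Implicit.
Unset Printing Implicit Defensive.

Import Order.TTheory GRing.Theory Num.Theory.
Local Open Scope ring_scope.

(* Sequences are indexed from 1: a 0 is a junk value that is never used. *)
Definition psum (a : nat -> int) (n : nat) : int := \sum_(1 <= i < n.+1) a i.

Definition galileo (R : realType) (a : nat -> int) (k : R) : Prop :=
  forall n : nat, (0 < n)%N -> (psum a (2 * n)%N)%:~R = k * (psum a n)%:~R.

Definition log2 (R : realType) (x : R) : R := ln x / ln 2.

Definition galileo_coef (R : realType) (a : nat -> int) (d : R) (m : nat) : R :=
  (psum a m)%:~R / m%:R `^ d.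

(* Main.v *)
Require Import Defs.
From mathcomp Require Import all_boot all_order all_algebra.
From mathcomp Require Import all_classical all_reals all_analysis.

Set Implicit Arguments.
Unset Strict Implicit.
Unset Printing Implicit Defensive.

Import Order.TTheory GRing.Theory Num.Theory.
Local Open Scope ring_scope.

(** The relation iterates to [S (2 ^ r * m) = k ^ r * S m], and [2 ^ d = k];
this gives (a). For (b), squeeze [n] between consecutive powers of two. For
(c), monotonicity of [a] gives [S n <= n * a n <= S (2 * n) - S n], and the
right-hand side is [(k - 1) * S n]. *)

Lemma powR2_log2 (R : realType) (x : R) : 0 < x -> 2 `^ log2 x = x.
Proof.
move=> x0; rewrite /powR pnatr_eq0 /= /log2 divfK ?lnK //.
by rewrite lt0r_neq0 // ln_gt0 // ltr1n.
Qed.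

Lemma log2_gt0 (R : realType) (x : R) : 1 < x -> 0 < log2 x.
Proof. by move=> x1; rewrite divr_gt0 // ln_gt0 // ltr1n. Qed.

(** The two exponents commute: [(2 ^ r) ^ d = (2 ^ d) ^ r] with [d = log2 x], and [2 ^ d = x]. *)
Lemma natrX_powR_log2 (R : realType) (x : R) (r : nat) :
  0 < x -> (2 ^ r)%:R `^ log2 x = x ^+ r.
Proof.
move=> x0; rewrite natrX -powR_mulrn ?ler0n // -powRrM mulrC powRrM.
by rewrite powR2_log2 // powR_mulrn // ltW.
Qed.

(** Serves to turn the exponent [d - 1] of (c) into the exponent [d] of (b) after multiplication by
    [n]. *)
Lemma powRB1 (R : realType) (x d : R) : 0 < x -> x `^ (d - 1) * x = x `^ d.
Proof.
by move=> x0; rewrite -{2}(powRr1 (ltW x0)) -powRD ?subrK // (gt_eqF x0) implybT.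
Qed.

Section PartialSums.
Variable a : nat -> int.

Lemma psum_cat (m n : nat) : (m <= n)%N ->
  psum a n = psum a m + \sum_(m.+1 <= i < n.+1) a i.
Proof. by move=> mn; rewrite /psum (big_cat_nat (n := m.+1)). Qed.

Lemma psum1 : psum a 1 = a 1%N.
Proof. exact: big_nat1. Qed.

Hypothesis a_pos : forall n : nat, (0 < n)%N -> 0 < a n.

Lemma le_psum (m n : nat) : (m <= n)%N -> psum a m <= psum a n.
Proof.
move=> mn; rewrite (psum_cat mn) lerDl big_nat sumr_ge0 // => i /andP[mi _].
by rewrite ltW // a_pos // (leq_trans _ mi).
Qed.

Hypothesis a_nondecr :
  forall m n : nat, (0 < m)%N -> (m <= n)%N -> a m <= a n.

(** None of the [n] terms exceeds the last one, [a n]. *)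
Lemma psum_le_mul (n : nat) : psum a n <= a n *+ n.
Proof.
rewrite -[X in _ *+ X](subn1 n.+1) -sumr_const_nat.
by apply: ler_sum_nat => i /andP[i0 iN]; apply: a_nondecr.
Qed.

(** The difference is the block of terms with indices [n + 1] to [2 * n]: there are [n] of them,
    each at least [a n]. *)
Lemma mul_le_psum_sub (n : nat) : (0 < n)%N ->
  a n *+ n <= psum a (2 * n) - psum a n.
Proof.
move=> n0; have n2n : (n <= 2 * n)%N by rewrite leq_pmull.
rewrite (psum_cat n2n) addrC addKr.
have -> : a n *+ n = a n *+ ((2 * n).+1 - n.+1).
  by rewrite subSS mul2n -addnn addnK.
rewrite -sumr_const_nat.
by apply: ler_sum_nat => i /andP[ni _]; apply: a_nondecr => //; apply: ltnW.
Qed.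

End PartialSums.

Lemma galileo_pow2 (R : realType) (a : nat -> int) (k : R) (r m : nat) :
  galileo a k -> (0 < m)%N ->
  (psum a (2 ^ r * m))%:~R = k ^+ r * (psum a m)%:~R.
Proof.
move=> gal m0; elim: r => [|r IH]; first by rewrite mul1n mul1r.
by rewrite expnS -mulnA gal ?IH ?exprS ?mulrA // muln_gt0 expn_gt0.
Qed.

Theorem theorem12 (R : realType) (a : nat -> int) (k : R)
  (a_pos : forall n : nat, (0 < n)%N -> 0 < a n)
  (a_nondecr : forall m n : nat, (0 < m)%N -> (m <= n)%N -> a m <= a n)
  (k_gt1 : 1 < k)
  (a_galileo : galileo a k) :
  let d : R := log2 k in
  [/\ forall n r m : nat, odd m -> n = (2 ^ r * m)%N ->
        (psum a n)%:~R = galileo_coef a d m * n%:R `^ d,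
      exists C1 C2 : R, [/\ 0 < C1, 0 < C2 &
        forall n : nat, (0 < n)%N ->
          C1 * n%:R `^ d <= (psum a n)%:~R <= C2 * n%:R `^ d]
    & exists D1 D2 : R, [/\ 0 < D1, 0 < D2 &
        forall n : nat, (0 < n)%N ->
          D1 * n%:R `^ (d - 1) <= (a n)%:~R <= D2 * n%:R `^ (d - 1)]].
Proof.
move=> d.
have k0 : 0 < k by apply: lt_trans k_gt1.
have d0 : 0 < d by apply: log2_gt0.
have s0 : 0 < (psum a 1)%:~R :> R by rewrite ltr0z psum1 a_pos.
set s : R := (psum a 1)%:~R in s0 *.
(* Rounding [n] to a power of two costs at most one factor [k] on either side of [s = S 1], hence
   the constants [s / k] and [s * k]. *)
have bounds n : (0 < n)%N ->
    s / k * n%:R `^ d <= (psum a n)%:~R <= s * k * n%:R `^ d.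
  move=> n0; set r := trunc_log 2 n.
  have rn : (2 ^ r <= n)%N by apply: trunc_logP.
  have nr : (n <= 2 ^ r.+1)%N by rewrite ltnW // trunc_log_ltn.
  have powR_mono (i j : nat) : (i <= j)%N -> i%:R `^ d <= j%:R `^ d :> R.
    by move=> ij; rewrite ge0_ler_powR ?nnegrE ?ler0n ?ler_nat // ltW.
  have psum_pow2 i : (psum a (2 ^ i))%:~R = s * k ^+ i :> R.
    by rewrite -[(2 ^ i)%N]muln1 (galileo_pow2 _ a_galileo) // mulrC.
  have lo := powR_mono _ _ rn; have hi := powR_mono _ _ nr.
  (* The squeeze on [n] becomes [k ^ r <= n ^ d <= k ^ r.+1]. *)
  rewrite !natrX_powR_log2 // in lo hi.
  apply/andP; split.
    apply: (@le_trans _ _ (psum a (2 ^ r))%:~R); last first.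
      by rewrite ler_int le_psum.
    rewrite psum_pow2 -mulrA ler_pM2l // mulrC ler_pdivrMr //.
    by rewrite -exprSr.
  apply: (@le_trans _ _ (psum a (2 ^ r.+1))%:~R).
    by rewrite ler_int le_psum.
  by rewrite psum_pow2 -mulrA ler_pM2l // exprS ler_pM2l.
split.
- move=> n r m m_odd ->; have m0 : (0 < m)%N by case: m m_odd.
  rewrite (galileo_pow2 _ a_galileo) // /galileo_coef natrM.
  (* Since [n ^ d = k ^ r * m ^ d], the factor [m ^ d] cancels the denominator of [c(m)]. *)
  rewrite powRM ?ler0n // natrX_powR_log2 // mulrCA divfK //.
  by rewrite gt_eqF // powR_gt0 // ltr0n.
- by exists (s / k), (s * k); split; rewrite ?divr_gt0 ?mulr_gt0.
- have k1 : 0 < k - 1 by rewrite subr_gt0.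
  (* These are the constants of (b), the upper one scaled by [k - 1] because
     [S (2 * n) - S n = (k - 1) * S n]. *)
  exists (s / k), ((k - 1) * (s * k)); split; rewrite ?divr_gt0 ?mulr_gt0 //.
  move=> n n0; have n0R : 0 < n%:R :> R by rewrite ltr0n.
  have /andP[lo hi] := bounds n n0.
  have an : (a n *+ n)%:~R = (a n)%:~R * n%:R :> R by rewrite rmorphMn mulr_natr.
  (* Multiplying both inequalities by [n > 0] leaves [n * a n] to be compared with multiples of
     [n ^ d]. *)
  apply/andP; split; rewrite -(ler_pM2r n0R) -an.
    by rewrite -(mulrA (s / k)) powRB1 // (le_trans lo) // ler_int psum_le_mul.
  rewrite -(mulrA ((k - 1) * _)) powRB1 //.
  apply: (@le_trans _ _ (psum a (2 * n) - psum a n)%:~R).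
    by rewrite ler_int mul_le_psum_sub.
  rewrite rmorphB /= a_galileo // -{2}[(psum a n)%:~R]mul1r -mulrBl.
  by rewrite -(mulrA (k - 1)) ler_pM2l.
Qed.
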